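(* Let $\mathcal{C}$ be the set of paths $P\in\mathcal{E}$ such that either (i) $P=(UD)^k$ for some $k\ge 0$, or (ii) $P=(UD)^{\ell_1}U^{k_1}C_{k_1}(UD)^{\ell_2}U^{k_2}C_{k_2}\cdots(UD)^{\ell_r}U^{k_r}C_{k_r}(UD)^{\ell_{r+1}}$ with $r\ge 1$, $\ell_i\ge 0$ for $1\le i\le r+1$, and $k_i\ge 2$ for $1\le i\le r$. The ordinary generating function $C(x)=\sum_{P\in\mathcal{C}}x^{|P|}$ of $\mathcal{C}$ with respect to the length is $$C(x)=\frac{1-x}{1-x-x^2},$$ and its series expansion is $$1+x^2+x^3+2x^4+3x^5+5x^6+8x^7+13x^8+21x^9+34x^{10}+55x^{11}+O(x^{12}).$$
   Context: A Dyck path with catastrophes is a finite lattice path in the first quadrant ($y\ge 0$) starting at the origin, ending on the $x$-axis, with steps $U=(1,1)$, $D=(1,-1)$ and catastrophe steps $C_k=(1,-k)$, $k\ge 2$, where a catastrophe step must end on the $x$-axis (so $C_k$ can only be used from height $k$). $\mathcal{E}$ is the set of all Dyck paths with catastrophes (including the empty path). The length $|P|$ is the number of steps of $P$; paths are written as words in the steps. Generating functions are formal power series in $x$. *)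

(* Defs.v *)
From HB Require Import structures.
From mathcomp Require Import all_boot all_order all_algebra finmap.
From mathcomp Require Import boolp classical_sets cardinality.

Set Implicit Arguments.
Unset Strict Implicit.
Unset Printing Implicit Defensive.

Import Order.TTheory GRing.Theory Num.Theory.

Local Open Scope ring_scope.

(** * Formal power series in one variable *)

(* A record rather than a bare [nat -> R], whose ring structure would be
   pointwise. *)
Record fps (R : Type) := FPS { fcoef : nat -> R }.

Section FpsRing.
Variable R : comUnitRingType.
Implicit Types f g h : fps R.

Lemma fpsP f g : (forall n, fcoef f n = fcoef g n) <-> f = g.
Proof.
split=> [|-> //]; case: f g => [f] [g] /= fg.
by congr FPS; apply: funext.
Qed.

HB.instance Definition _ := gen_eqMixin (fps R).
HB.instance Definition _ := gen_choiceMixin (fps R).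

Definition fps_zero : fps R := FPS (fun=> 0).
Definition fps_opp f : fps R := FPS (fun n => - fcoef f n).
Definition fps_add f g : fps R := FPS (fun n => fcoef f n + fcoef g n).
Definition fps_one : fps R := FPS (fun n => (n == 0)%:R).
Definition fps_mul f g : fps R :=
  FPS (fun n => \sum_(i < n.+1) fcoef f i * fcoef g (n - i)%N).

Fact fps_addA : associative fps_add.
Proof. by move=> f g h; apply/fpsP => n /=; rewrite addrA. Qed.
Fact fps_addC : commutative fps_add.
Proof. by move=> f g; apply/fpsP => n /=; rewrite addrC. Qed.
Fact fps_add0 : left_id fps_zero fps_add.
Proof. by move=> f; apply/fpsP => n /=; rewrite add0r. Qed.
Fact fps_addN : left_inverse fps_zero fps_opp fps_add.
Proof. by move=> f; apply/fpsP => n /=; rewrite addNr. Qed.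

HB.instance Definition _ := GRing.isZmodule.Build (fps R)
  fps_addA fps_addC fps_add0 fps_addN.

Definition fps_trunc N f : {poly R} := \poly_(i < N) fcoef f i.

Fact fps_mul_trunc N f g n : (n < N)%N ->
  fcoef (fps_mul f g) n = (fps_trunc N f * fps_trunc N g)`_n.
Proof.
move=> nN; rewrite coefM /=; apply: eq_bigr => i _; rewrite !coef_poly.
by rewrite !(leq_ltn_trans _ nN) ?leq_subr // -ltnS.
Qed.

Fact fps_mulC : commutative fps_mul.
Proof.
by move=> f g; apply/fpsP => n; rewrite !(@fps_mul_trunc n.+1) // mulrC.
Qed.

Fact fps_mulA : associative fps_mul.
Proof.
move=> f g h; apply/fpsP => n.
transitivity ((fps_trunc n.+1 f * (fps_trunc n.+1 g * fps_trunc n.+1 h))`_n).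
  rewrite coefM; apply: eq_bigr => i _; rewrite coef_poly ltn_ord.
  by rewrite -fps_mul_trunc // ltnS leq_subr.
rewrite mulrA coefM; apply: eq_bigr => i _; rewrite coef_poly ltnS leq_subr.
by rewrite -fps_mul_trunc // ltn_ord.
Qed.

Fact fps_mul1 : left_id fps_one fps_mul.
Proof.
move=> f; apply/fpsP => n /=; rewrite big_ord_recl /= mul1r subn0.
by rewrite big1 ?addr0 // => i _; rewrite mul0r.
Qed.

Fact fps_mulDl : left_distributive fps_mul fps_add.
Proof.
move=> f g h; apply/fpsP => n /=; rewrite -big_split /=.
by apply: eq_bigr => i _; rewrite mulrDl.
Qed.

Fact fps_one_neq0 : fps_one != fps_zero.
Proof.
apply/eqP => /fpsP /(_ 0%N) /= e10.
by have := oner_neq0 R; rewrite -e10 eqxx.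
Qed.

HB.instance Definition _ := GRing.Zmodule_isComNzRing.Build (fps R)
  fps_mulA fps_mulC fps_mul1 fps_mulDl fps_one_neq0.

(* The coefficients of order [< n] of the inverse of [f], obtained by solving
   [f * g = 1] for [g] one coefficient at a time. *)
Fixpoint fps_inv_seq f n : seq R :=
  if n is m.+1 then
    let s := fps_inv_seq f m in
    rcons s ((fcoef f 0)^-1 *
             ((m == 0)%:R - \sum_(i < m) fcoef f i.+1 * s`_(m - i.+1)%N))
  else [::].

Definition fps_unit : {pred fps R} :=
  [pred f | fcoef f 0 \is a GRing.unit].

Definition fps_inv f : fps R :=
  if f \in fps_unit then FPS (fun n => (fps_inv_seq f n.+1)`_n) else f.

Fact size_fps_inv_seq f n : size (fps_inv_seq f n) = n.
Proof. by elim: n => //= n IHn; rewrite size_rcons IHn. Qed.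

Fact nth_fps_inv_seq f n m : (m < n)%N ->
  (fps_inv_seq f n)`_m = (fps_inv_seq f m.+1)`_m.
Proof.
elim: n => // n IHn; rewrite ltnS leq_eqVlt => /predU1P[-> //|mn].
by rewrite [LHS]nth_rcons size_fps_inv_seq mn IHn.
Qed.

Fact fps_mulVx : {in fps_unit, left_inverse 1 fps_inv *%R}.
Proof.
move=> f Uf; rewrite mulrC; apply/fpsP => n.
rewrite [LHS]/= /fps_inv Uf [LHS]big_ord_recl /= subn0.
rewrite nth_rcons size_fps_inv_seq ltnn eqxx mulVKr //.
rewrite addrC [X in X + _](_ : _ =
  \sum_(i < n) fcoef f i.+1 * (fps_inv_seq f n)`_(n - i.+1)); last first.
  apply: eq_bigr => i _; rewrite /bump add1n.
  by rewrite [in RHS]nth_fps_inv_seq // ltn_subrL (leq_trans _ (ltn_ord i)).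
by rewrite addrC subrK.
Qed.

Fact fps_unitPl f g : g * f = 1 -> fps_unit f.
Proof.
move=> /fpsP /(_ 0%N) /=; rewrite big_ord1 subn0 => gf1.
by apply/unitrPr; exists (fcoef g 0); rewrite mulrC.
Qed.

Fact fps_invr_out : {in [predC fps_unit], fps_inv =1 id}.
Proof. by move=> f; rewrite inE /fps_inv => /negbTE ->. Qed.

HB.instance Definition _ := GRing.ComNzRing_hasMulInverse.Build (fps R)
  fps_mulVx fps_unitPl fps_invr_out.

Definition fpsX : fps R := FPS (fun n => (n == 1)%:R).

(* [f = g + O(x^N)] *)
Definition fps_eqO N f g : Prop :=
  forall n, (n < N)%N -> fcoef f n = fcoef g n.

End FpsRing.

Arguments fpsX {R}.

(** * Dyck paths with catastrophes *)

(* [Cat k] is the step (1,-k); the constraint [2 <= k] is imposed on paths. *)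
Inductive step := U | D | Cat of nat.

Definition step_code (s : step) : option (option nat) :=
  match s with U => None | D => Some None | Cat k => Some (Some k) end.
Definition step_decode (c : option (option nat)) : step :=
  match c with None => U | Some None => D | Some (Some k) => Cat k end.
Lemma step_codeK : cancel step_code step_decode. Proof. by case. Qed.
HB.instance Definition _ := Countable.copy step (can_type step_codeK).

Definition rise (s : step) : int :=
  match s with U => 1 | D => -1 | Cat k => - k%:Z end.

Definition height (P : seq step) : int := \sum_(s <- P) rise s.

Definition dyck_cat : set (seq step) := [set P : seq step |
  [/\ forall Q, prefix Q P -> 0 <= height Q,
      height P = 0
    & forall Q k, prefix (rcons Q (Cat k)) P ->
        (2 <= k)%N /\ height (rcons Q (Cat k)) = 0]].

Definition wpow (w : seq step) n : seq step := flatten (nseq n w).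

Definition pathsC : set (seq step) := [set P : seq step | dyck_cat P /\
  ((exists k : nat, P = wpow [:: U; D] k) \/
   (exists (r : nat) (l k : nat -> nat),
      [/\ (1 <= r)%N,
          forall i, (1 <= i <= r)%N -> (2 <= k i)%N
        & P = \big[cat/[::]]_(1 <= i < r.+1)
                (wpow [:: U; D] (l i) ++ wpow [:: U] (k i) ++ [:: Cat (k i)])
              ++ wpow [:: U; D] (l r.+1)]))].

(* [fset_set] is the empty set on infinite sets; by [finite_dyck_cat] below this
   does not occur when [A] is contained in [dyck_cat]. *)
Definition ogf (A : set (seq step)) : fps rat :=
  FPS (fun n => (#|` fset_set [set P | A P /\ size P = n]|%fset)%:R).

Lemma height_rcons Q s : height (rcons Q s) = height Q + rise s.
Proof. by rewrite /height -cats1 big_cat big_seq1. Qed.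

Lemma height_le_size Q : height Q <= (size Q)%:Z.
Proof.
elim/last_ind: Q => [|Q s IH]; first by rewrite /height big_nil.
rewrite height_rcons size_rcons -addn1 PoszD lerD //.
by case: s => //= k; rewrite (le_trans _ ler01) // oppr_le0.
Qed.

Lemma finite_dyck_cat n : finite_set [set P | dyck_cat P /\ size P = n].
Proof.
pose letter (o : option (option 'I_n.+1)) : step :=
  match o with None => U | Some None => D | Some (Some k) => Cat k end.
pose word (t : n.-tuple (option (option 'I_n.+1))) := map letter t.
apply: (@sub_finite_set _ _ (word @` setT)); last exact: finite_image.
move=> P [[_ _ Pcat] sizeP].
have Plet s : s \in P -> exists o, letter o = s.
  move=> sP; case: s sP => [_|_|k kP]; [by exists None | by exists (Some None)|].
  case/splitPr: kP Pcat sizeP => P1 P2 /(_ P1 k).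
  rewrite -cat_rcons prefix_prefix => /(_ isT)[_].
  rewrite height_rcons => /eqP; rewrite subr_eq0 => /eqP hk sizeP.
  have kn : (k < n.+1)%N.
    rewrite ltnS -sizeP size_cat size_rcons -lez_nat -hk.
    rewrite (le_trans (height_le_size P1)) // lez_nat.
    by rewrite (leq_trans (leqnSn _)) // leq_addr.
  by exists (Some (Some (Ordinal kn))).
suff [q Pq] : exists q, P = map letter q.
  have sq : size q == n by apply/eqP; rewrite -[RHS]sizeP Pq size_map.
  by rewrite Pq; exists (Tuple sq).
elim: (P) Plet => [|s Q IH] Qlet; first by exists [::].
have [o <-] := Qlet s (mem_head _ _).
have [|q ->] := IH; first by move=> s' s'Q; apply: Qlet; rewrite inE s'Q orbT.
by exists (o :: q).
Qed.

(* Main.v *)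
Require Import Defs.
From HB Require Import structures.
From mathcomp Require Import all_boot all_order all_algebra finmap.
From mathcomp Require Import boolp classical_sets cardinality.
Import Order.TTheory GRing.Theory Num.Theory.
Local Open Scope ring_scope.

(* A path of the class is a sequence of blocks [U D] (length 2) and [U^k C_k]
   (length k + 1 >= 3). There is exactly one block of each length at least 2, and
   the number of leading [U]s of a path determines its first block, so the paths
   of length n correspond to the compositions of n into parts at least 2. Either
   the first part is 2, or it can be decreased by 1: the numbers a_n of these
   compositions satisfy a_(n+2) = a_n + a_(n+1), with a_0 = 1 and a_1 = 0. *)

(** * Words of blocks and their decoding *)

(** [m = 2] is exceptional because [Cat 1] is not admissible: there [D] closes the block. *)
Definition block (m : nat) : seq step :=
  rcons (nseq m.-1 U) (if m == 2%N then D else Cat m.-1).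

Definition path_of_parts (s : seq nat) : seq step := flatten (map block s).

Lemma size_block m : (0 < m)%N -> size (block m) = m.
Proof. by move=> m0; rewrite size_rcons size_nseq prednK. Qed.

Lemma size_path_of_parts s : all (leq 2) s -> size (path_of_parts s) = sumn s.
Proof.
elim: s => //= m s IHs /andP[m2 s2].
by rewrite /path_of_parts /= size_cat size_block ?(ltnW m2) // -IHs.
Qed.

(** The closing letter is the first one other than [U], so its position reveals [m] whatever
    follows. *)
Lemma find_block m P : find (predC1 U) (block m ++ P) = m.-1.
Proof.
rewrite /block cat_rcons find_cat has_nseq andbF size_nseq /=.
by case: (m == 2%N); rewrite addn0.
Qed.

Lemma path_of_parts_inj s t : all (leq 2) s -> all (leq 2) t ->
  path_of_parts s = path_of_parts t -> s = t.
Proof.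
elim: s t => [|m s IHs] [|p t] //=.
- by move=> _ _ /(congr1 size); rewrite size_cat size_rcons.
- by move=> _ _ /(congr1 size); rewrite size_cat size_rcons.
move=> /andP[m2 s2] /andP[p2 t2]; rewrite /path_of_parts /= => eq_st.
have eq_mp : m = p.
  rewrite -(prednK (ltnW m2)) -(prednK (ltnW p2)).
  by rewrite -(find_block m (flatten (map block s))) eq_st find_block.
move: eq_st; rewrite eq_mp => /eqP; rewrite eqseq_cat // eqxx /= => /eqP.
by move/(IHs t s2 t2) ->.
Qed.

(** * Words of blocks are Dyck paths with catastrophes *)

Lemma height_cat P Q : height (P ++ Q) = height P + height Q.
Proof. by rewrite /height big_cat. Qed.

Lemma height_nseqU n : height (nseq n U) = n%:Z.
Proof. by rewrite /height big_nseq iter_addr_0 -mulr_natl mulr1 natz. Qed.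

Lemma prefix_cat_or (T : eqType) (R P Q : seq T) : prefix R (P ++ Q) ->
  prefix R P \/ exists2 R', R = P ++ R' & prefix R' Q.
Proof.
elim: P R => [|x P IHP] [|y R] //=.
- by right; exists [::].
- by right; exists (y :: R).
- by left.
case/andP=> /eqP -> /IHP[RP|[R' -> R'Q]].
  by left; rewrite eqxx.
by right; exists R'.
Qed.

Lemma dyck_cat_nil : dyck_cat [::].
Proof.
split=> [Q||Q k]; rewrite ?prefixs0 /height ?big_nil //.
  by move=> /eqP ->; rewrite big_nil.
by rewrite -size_eq0 size_rcons.
Qed.

(** As [P] ends on the axis, a prefix going beyond [P] has the height of its part in [Q]. *)
Lemma dyck_cat_cat P Q : dyck_cat P -> dyck_cat Q -> dyck_cat (P ++ Q).
Proof.
move=> [P1 P2 P3] [Q1 Q2 Q3]; split.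
- move=> R /prefix_cat_or[/P1 //|[R' -> /Q1]].
  by rewrite height_cat P2 add0r.
- by rewrite height_cat P2 Q2.
- move=> R k /prefix_cat_or[/P3 //|[R']].
  (* If the prefix stops exactly where [P] ends, its last step belongs to [P]. *)
  case/lastP: R' => [|R' s].
    by rewrite cats0 => eP _; apply: P3; rewrite eP prefix_refl.
  rewrite -rcons_cat => /rcons_inj[-> <-] /Q3.
  by rewrite rcons_cat height_cat P2 add0r.
Qed.

Lemma dyck_cat_block m : (2 <= m)%N -> dyck_cat (block m).
Proof.
move=> m2; have h0 : height (block m) = 0.
  rewrite /block height_rcons height_nseqU.
  by case: eqP => [->|_]; rewrite /= subrr.
(* Proper prefixes contain only up-steps, so only the whole block can end in a catastrophe. *)
have prefE R : prefix R (block m) ->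
    R = block m \/ exists j, R = nseq j U.
  rewrite /block -cats1 => /prefix_cat_or[/prefixP[R' e]|[R' ->]].
    right; exists (size R); apply/all_pred1P.
    have : all (pred1 U) (nseq m.-1 U) by rewrite all_pred1_nseq.
    by rewrite e all_cat => /andP[].
  case: R' => [|x [|y R']] /=; last by rewrite andbF.
    by rewrite cats0; right; exists m.-1.
  by case/andP=> /eqP -> _; left.
split=> // [R /prefE[->|[j ->]]|R k /prefE[e|[j e]]].
- by rewrite h0.
- by rewrite height_nseqU.
- split; last by rewrite e h0.
  move: e; rewrite /block => /rcons_inj[_].
  case: eqP => // /eqP m_neq2 [->].
  by rewrite -ltnS prednK ?(ltnW m2) // ltn_neqAle eq_sym m_neq2.
- have : Cat k \in nseq j U by rewrite -e mem_rcons mem_head.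
  by rewrite mem_nseq andbF.
Qed.

Lemma dyck_cat_path_of_parts s : all (leq 2) s -> dyck_cat (path_of_parts s).
Proof.
elim: s => [_|m s IHs /= /andP[m2 s2]]; first exact: dyck_cat_nil.
by apply: dyck_cat_cat; [exact: dyck_cat_block|exact: IHs].
Qed.

(** * The class as the set of words of blocks *)

Lemma wpow1 (a : step) n : wpow [:: a] n = nseq n a.
Proof. by elim: n => //= n <-. Qed.

Lemma block_cat k : (2 <= k)%N -> block k.+1 = wpow [:: U] k ++ [:: Cat k].
Proof. by rewrite /block wpow1 cats1 eqSS; case: eqP => // ->. Qed.

Lemma wpowUD n : wpow [:: U; D] n = path_of_parts (nseq n 2).
Proof. by rewrite /path_of_parts map_nseq. Qed.

(** The word of the second alternative in [pathsC]; [r = 0] gives the first, so one induction serves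
    both. *)
Definition peak_cat_form (r : nat) (l k : nat -> nat) : seq step :=
  \big[cat/[::]]_(1 <= i < r.+1)
    (wpow [:: U; D] (l i) ++ wpow [:: U] (k i) ++ [:: Cat (k i)])
  ++ wpow [:: U; D] (l r.+1).

Lemma path_of_parts_form s : all (leq 2) s -> exists r l k,
  (forall i, (1 <= i <= r)%N -> (2 <= k i)%N) /\
  path_of_parts s = peak_cat_form r l k.
Proof.
elim: s => [_|m s IHs /= /andP[m2 s2]].
  exists 0%N, (fun=> 0%N), (fun=> 0%N); split=> [i /andP[]|].
    by case: i.
  by rewrite /peak_cat_form big_geq.
have [r [l [k [k2 es]]]] := IHs s2.
rewrite /path_of_parts /= -/(path_of_parts s) es.
have [->|m_neq2] := eqVneq m 2%N.
  (* A leading [U D] lengthens the first run, which is also the last one when [r = 0]. *)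
  exists r, (fun i => l i + (i == 1))%N, k; split=> //; rewrite /peak_cat_form.
  case: r {k2 es} => [|r]; first by rewrite !big_geq // addn1.
  rewrite big_ltn // [in RHS]big_ltn // addn1 addn0 -!catA.
  do 5!congr (_ ++ _).
  by apply: eq_big_nat => -[|[|i]] //; rewrite addn0.
have m3 : (2 <= m.-1)%N.
  by rewrite -ltnS prednK ?(ltnW m2) // ltn_neqAle eq_sym m_neq2.
(* A leading catastrophe block shifts both sequences by one and follows an empty run of [U D]. *)
exists r.+1, (fun i => if i is j.+2 then l j.+1 else 0%N),
  (fun i => if i is j.+2 then k j.+1 else m.-1); split.
  by move=> [|[|i]] //= ir; apply: k2.
rewrite /peak_cat_form [in RHS]big_ltn // [in RHS]big_add1 /= -!catA.
rewrite -{1}(prednK (ltnW m2)) block_cat // -!catA; do 3!congr (_ ++ _).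
by apply: eq_big_nat => -[|i].
Qed.

Lemma pathsCP P :
  pathsC P <-> exists2 s, all (leq 2) s & P = path_of_parts s.
Proof.
split=> [[_ H]|[s s2 ->]]; last first.
  split; first exact: dyck_cat_path_of_parts.
  have [[|r] [l [k [k2 ->]]]] := path_of_parts_form s s2; last first.
    by right; exists r.+1, l, k.
  by left; exists (l 1%N); rewrite /peak_cat_form big_geq.
pose has_parts Q := exists2 s, all (leq 2) s & Q = path_of_parts s.
have cat_parts Q R : has_parts Q -> has_parts R -> has_parts (Q ++ R).
  move=> [s s2 ->] [t t2 ->]; exists (s ++ t); first by rewrite all_cat s2.
  by rewrite /path_of_parts map_cat flatten_cat.
have UD_parts n : has_parts (wpow [:: U; D] n).
  by exists (nseq n 2%N); rewrite ?wpowUD // all_nseq orbT.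
rewrite -/(has_parts P); case: H => [[n ->] //|[r [l [k [_ k2 ->]]]]].
apply: (cat_parts _ _ _ (UD_parts _)); rewrite big_nat_cond.
apply: (big_ind has_parts) => [|//|i]; first by exists [::].
rewrite andbT ltnS => /k2 ki2; apply: cat_parts => //.
exists [:: (k i).+1]; first by rewrite /= ltnW.
by rewrite /path_of_parts /= cats0 block_cat.
Qed.

(** * Compositions into parts at least 2 *)

Fixpoint compositions (n : nat) : seq (seq nat) :=
  match n with
  | 0 => [:: [::]]
  | 1 => [::]
  | (n'.+1 as p).+1 =>
      map (cons 2%N) (compositions n') ++ map (incr_nth^~ 0%N) (compositions p)
  end.

Lemma compositionsSS n : compositions n.+2 =
  map (cons 2%N) (compositions n) ++ map (incr_nth^~ 0%N) (compositions n.+1).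
Proof. by []. Qed.

Lemma mem_compositions n s :
  (s \in compositions n) = all (leq 2) s && (sumn s == n).
Proof.
(* The recursion reaches back two steps, so consecutive values are treated together. *)
suff: (forall s, (s \in compositions n) = all (leq 2) s && (sumn s == n)) /\
      (forall s, (s \in compositions n.+1) = all (leq 2) s && (sumn s == n.+1)).
  by case.
elim: n {s} => [|n [IHn IHn1]].
  by split=> -[|[|[|m]] s] //=; rewrite ?inE !addSn ?andbF.
split=> // s; rewrite compositionsSS mem_cat; apply/orP/idP.
  case=> /mapP[t]; rewrite ?IHn ?IHn1 => /andP[t2 /eqP e] -> /=.
    by rewrite t2 e /=.
  case: t t2 e => //= m t /andP[m2 ->]; rewrite addSn => ->.
  by rewrite (leqW m2) eqxx.
case: s => [|[|[|[|m]]] s] //= /andP[s2 e].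
  by left; apply: map_f; rewrite IHn s2 -(eqn_add2l 2).
by right; apply/mapP; exists (m.+2 :: s); rewrite // IHn1 /= s2 -eqSS -addSn.
Qed.

Lemma uniq_compositions n : uniq (compositions n).
Proof.
suff: uniq (compositions n) /\ uniq (compositions n.+1) by case.
elim: n => [//|n [IHn IHn1]]; split=> //; rewrite compositionsSS cat_uniq.
apply/and3P; split.
- by rewrite map_inj_uniq // => s t [].
(* An increased first part is at least 3, so the two halves are disjoint. *)
- apply/hasPn => _ /mapP[s + ->]; rewrite mem_compositions.
  case: s => //= m s /andP[/andP[m2 _] _]; apply/mapP => -[t _ [em _]].
  by rewrite em in m2.
(* [incr_nth^~ 0] sends both [[::]] and [[:: 0]] to [[:: 1]]; it is injective only among the
   nonempty lists. *)
- rewrite map_inj_in_uniq // => s t; rewrite !mem_compositions.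
  by case: s t => [|m s] [|p t] //= _ _ [-> ->].
Qed.

Lemma fcoef_ogf_pathsC n : fcoef (ogf pathsC) n = (size (compositions n))%:R.
Proof.
rewrite /=; congr (_%:R).
(* An explicit finite set makes [fset_set] computable; its size follows by injectivity of
   [path_of_parts]. *)
have -> : [set P | pathsC P /\ size P = n]%classic =
    [set` [fset P in map path_of_parts (compositions n)]%fset]%classic.
  apply/seteqP; split=> P /=; rewrite inE.
    case=> /pathsCP[s s2 ->]; rewrite size_path_of_parts // => sn.
    by apply: map_f; rewrite mem_compositions s2 sn /=.
  case/mapP=> s; rewrite mem_compositions => /andP[s2 /eqP sn] ->.
  by rewrite size_path_of_parts // sn; split=> //; apply/pathsCP; exists s.
rewrite set_fsetK card_fseq undup_id ?size_map //.
rewrite map_inj_in_uniq ?uniq_compositions // => s t.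
rewrite !mem_compositions => /andP[s2 _] /andP[t2 _].
exact: path_of_parts_inj.
Qed.

(** * Coefficients of power series *)

Section FpsCoefficients.
Variable R : comUnitRingType.
Implicit Types f g : fps R.

Lemma fcoefD f g n : fcoef (f + g) n = fcoef f n + fcoef g n.
Proof. by []. Qed.

Lemma fcoefN f n : fcoef (- f) n = - fcoef f n.
Proof. by []. Qed.

Lemma fcoef1 n : fcoef (1 : fps R) n = (n == 0)%:R.
Proof. by []. Qed.

Lemma fcoefMn f m n : fcoef (f *+ m) n = fcoef f n *+ m.
Proof. by elim: m => // m IHm; rewrite !mulrS fcoefD IHm. Qed.

Lemma fcoefXM f n : fcoef (fpsX * f) n = if n is m.+1 then fcoef f m else 0.
Proof.
rewrite /= big_ord_recl /= mul0r add0r.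
case: n => [|n]; first by rewrite big_ord0.
rewrite big_ord_recl /= mul1r subSS subn0 big1 ?addr0 // => i _.
by rewrite mul0r.
Qed.

Lemma fcoefXn m n : fcoef (fpsX ^+ m : fps R) n = (n == m)%:R.
Proof. by elim: m n => // m IHm [|n]; rewrite exprS fcoefXM. Qed.

Lemma fcoef_natXn m i n :
  fcoef (m%:R * fpsX ^+ i : fps R) n = (m * (n == i))%:R.
Proof. by rewrite mulr_natl fcoefMn fcoefXn natrM mulr_natl. Qed.

(* The next lemma is only ever applied, never rewritten with: occurrence search
   by rewrite would compare distinct numerals of [fps R] by unfolding them. *)
Lemma fcoefD_nat f g n a b : fcoef g n = b%:R -> fcoef f n = a%:R ->
  fcoef (f + g) n = (a + b)%:R.
Proof. by rewrite natrD => <- <-. Qed.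

End FpsCoefficients.

Arguments fcoefXn {R}.
Arguments fcoef_natXn {R}.
Arguments fcoefD_nat {R f g n a b}.

Theorem theorem2p6 :
  let x : fps rat := fpsX in
  ogf pathsC = (1 - x) / (1 - x - x ^+ 2) /\
  fps_eqO 12 (ogf pathsC)
    (1 + x ^+ 2 + x ^+ 3 + 2 * x ^+ 4 + 3 * x ^+ 5 + 5 * x ^+ 6 + 8 * x ^+ 7
     + 13 * x ^+ 8 + 21 * x ^+ 9 + 34 * x ^+ 10 + 55 * x ^+ 11).
Proof.
move=> x; split.
  have Ud : 1 - x - x ^+ 2 \is a GRing.unit.
    suff : fcoef (1 - x - x ^+ 2) 0 \is a GRing.unit by [].
    by rewrite !(fcoefD, fcoefN, fcoef1) fcoefXn !subr0 unitr1.
  (* Clearing the denominator leaves a linear recurrence to be checked coefficientwise. *)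
  apply: (mulIr Ud); rewrite mulrVK // mulrC !mulrBl mul1r expr2 -mulrA.
  apply/fpsP => -[|[|n]];
    rewrite !(fcoefD, fcoefN, fcoef1, fcoefXM) !fcoef_ogf_pathsC.
  - by rewrite !subr0.
  - by rewrite subr0.
  (* This is a_(n+2) - a_(n+1) - a_n = 0. *)
  - by rewrite compositionsSS size_cat !size_map natrD addrK subrr subr0.
move=> n n12; rewrite fcoef_ogf_pathsC; apply/esym.
(* The coefficient of the polynomial is gathered into a single natural number, so that each [n < 12]
   is settled by computation in [nat]. *)
etransitivity.
  do 8!refine (fcoefD_nat (fcoef_natXn _ _ n) _).
  by do 2!refine (fcoefD_nat (fcoefXn _ n) _); exact: fcoef1.
congr (_%:R).
by do 12!(case: n n12 => [//|n n12]).
Qed.
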